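(* If $P\in\mathcal I(2)$ is nonzero, indecomposable, and of p-degree $d$, then $d\le 2N(P)-5$.
   Context: $S(X)=X_0+X_1+\dots+X_n$. $\mathcal I(n)$ denotes the set of homogeneous polynomials $P\in\mathbb R[X_0,\dots,X_n]$ with $P(X)=0$ whenever $S(X)=0$. $N(P)$ is the number of distinct monomials of $P$ with nonzero coefficient. The p-degree of $P$ is the smallest integer $d$ such that $P=X^\alpha R$ for some monomial $X^\alpha$ and some polynomial $R$ of degree $d$. $P\in\mathcal I(n)$ is indecomposable if one cannot write $P=P_1+P_2$ with $P_1,P_2\in\mathcal I(n)$ both nonzero and having no monomial in common. *)

(* Defs.v *)
(* Polynomials in X0,X1,X2 are encoded as iterated
   univariate polynomials {poly {poly {poly R}}} = R[X0][X1][X2]. *)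
From HB Require Import structures.
From mathcomp Require Import all_boot all_order all_algebra.
Set Implicit Arguments. Unset Strict Implicit. Unset Printing Implicit Defensive.
Import Order.TTheory GRing.Theory Num.Theory.
Local Open Scope ring_scope.

Notation mpoly3 R := {poly {poly {poly R}}}.

Section Poly3.
Variable R : realFieldType.

Definition X0 : mpoly3 R := (('X : {poly R})%:P)%:P.
Definition X1 : mpoly3 R := ('X : {poly {poly R}})%:P.
Definition X2 : mpoly3 R := 'X.

Definition coef3 (P : mpoly3 R) (i j k : nat) : R := ((P`_k)`_j)`_i.

Definition eval3 (P : mpoly3 R) (x0 x1 x2 : R) : R :=
  ((P.[(x2%:P)%:P]).[x1%:P]).[x0].

Definition supp3 (P : mpoly3 R) : seq (nat * nat * nat) :=
  [seq t <- flatten [seq [seq (i, j, k) | j <- iota 0 (size P`_k),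
                                           i <- iota 0 (size (P`_k)`_j)]
                     | k <- iota 0 (size P)]
   | coef3 P t.1.1 t.1.2 t.2 != 0].

Definition Nmon (P : mpoly3 R) : nat := size (supp3 P).

(* total degree (for P <> 0) *)
Definition tdeg (P : mpoly3 R) : nat :=
  \max_(t <- supp3 P) (t.1.1 + t.1.2 + t.2)%N.

Definition homogeneous3 (P : mpoly3 R) : Prop :=
  exists D : nat, forall i j k, coef3 P i j k != 0 -> (i + j + k)%N = D.

Definition in_I2 (P : mpoly3 R) : Prop :=
  homogeneous3 P /\
  forall x0 x1 x2 : R, x0 + x1 + x2 = 0 -> eval3 P x0 x1 x2 = 0.

Definition indecomposable (P : mpoly3 R) : Prop :=
  in_I2 P /\
  ~ (exists P1 P2 : mpoly3 R,
        [/\ in_I2 P1 /\ in_I2 P2, P1 != 0, P2 != 0, P = P1 + P2 &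
            forall i j k, coef3 P1 i j k != 0 -> coef3 P2 i j k = 0]).

Definition monomial3 (a b c : nat) : mpoly3 R := X0 ^+ a * X1 ^+ b * X2 ^+ c.

Definition is_pdeg (P : mpoly3 R) (d : nat) : Prop :=
  (exists a b c (Q : mpoly3 R), P = monomial3 a b c * Q /\ tdeg Q = d) /\
  (forall a b c (Q : mpoly3 R), P = monomial3 a b c * Q -> (d <= tdeg Q)%N).

End Poly3.

(* Main.v *)
(** Up to a monomial factor, [P = S Q] with [S = X0 + X1 + X2].  Arrange the coefficients of [Q]
    as the cells of a triangle, in rows [Q_k] indexed by the exponent [k] of [X2]; a coefficient
    of [P] is the sum of the three cells meeting at a vertex, so it can only vanish if these cells
    are all zero or include both signs.  Indecomposability says that the support of [Q] is
    connected, and minimality of the degree that it touches the three sides.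

    From [(X0 + X1) Q_k = P_k - Q_(k-1)] and Descartes' rule of signs (after [X1 -> - X1]), the
    number [V] of sign variations satisfies [V(Q_k) + 1 <= V(Q_(k-1)) + 2 N_k], where [N_k] is the
    number of nonzero vertices in row [k].  Summing over the rows gives the bound when [Q] contains
    a power of [X2], that is, when the support reaches the top corner of the triangle.  Otherwise,
    call holes the zero cells that can be reached from the first zero row by moving sideways and
    downwards through zero cells.  By connectedness they never reach row 0, for a chain of holes
    from top to bottom would cut the support in two.  Crediting each row for its holes on top of
    its sign variations yields an energy that satisfies the same inequality, and that is large
    enough in the last nonzero row to pay for the missing rows above it. *)
Require Import Defs.
From HB Require Import structures.
From mathcomp Require Import all_boot all_order all_algebra.
From mathcomp Require Import zify lra.
Set Implicit Arguments. Unset Strict Implicit. Unset Printing Implicit Defensive.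
Import Order.TTheory GRing.Theory Num.Theory.
Local Open Scope ring_scope.

(** * Sign patterns of rows *)

Section Rows.

Local Open Scope nat_scope.

Variant letter := Hole | Zero | Sgn of bool.

Definition is_hole x := if x is Hole then true else false.
Definition is_zero x := if x is Zero then true else false.
Definition is_sgn x := if x is Sgn _ then true else false.

(* Signs are compared after multiplying the [j]-th letter by [(-1)^j], so [last] is negated at
   each step: [Some s] means that the sign [s] would be no variation at the current position, and
   [None] that no sign was met since the last hole. *)
Definition gain (prev : letter) (last : option bool) (x : letter) : nat :=
  match x with
  | Hole => is_hole prev
  | Zero => 0
  | Sgn s => last != Some s
  end.

Definition next_last (last : option bool) (x : letter) : option bool :=
  match x with
  | Hole => None
  | Zero => omap negb last
  | Sgn s => Some (~~ s)
  end.

Fixpoint energy_from (prev : letter) (last : option bool) (s : seq letter) : nat :=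
  if s is x :: s' then gain prev last x + energy_from x (next_last last x) s'
  else 2 * is_hole prev.

(* One plus the sign variations for each hole-free segment, plus the number of pairs of adjacent
   holes, plus 2 for each end of the row that is a hole. *)
Definition energy (s : seq letter) : nat :=
  2 * is_hole (head Zero s) + energy_from Zero None s.

Definition sgn_in (s : bool) (x : letter) := if x is Sgn t then s == t else false.

(** Exactly one of the two signs occurs, which forces a nonzero sum at the vertex. *)
Definition one_signed (x y z : letter) : bool :=
  has (sgn_in true) [:: x; y; z] (+) has (sgn_in false) [:: x; y; z].

(** Scans the vertices between a row [b] and the row [a] below it, one cell longer; [prev] is the
    previous letter of [b]. *)
Fixpoint one_signed_count (prev : letter) (a b : seq letter) : nat :=
  match a, b with
  | x :: a', y :: b' => one_signed prev y x + one_signed_count y a' b'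
  | x :: _, [::] => one_signed prev Zero x
  | _, _ => 0
  end.

(** Here [x] lies just below the adjacent cells [prev] and [y]: holes spread downwards through
    zeros. *)
Definition hole_ok (prev x y : letter) :=
  is_hole prev || is_hole y ==> ~~ is_zero x.

Definition side_ok (x y : letter) :=
  (is_hole x ==> ~~ is_zero y) && (is_hole y ==> ~~ is_zero x).

Fixpoint compat_from (pb pa : letter) (a b : seq letter) : bool :=
  match b, a with
  | y :: b', x :: a' =>
      [&& hole_ok pb x y, side_ok pb y, side_ok pa x & compat_from y x a' b']
  | [::], [:: x] => hole_ok pb x Zero && side_ok pa x
  | _, _ => false
  end.

Definition compat (a b : seq letter) : bool :=
  match a, b with
  | x :: a', y :: b' => hole_ok Zero x y && compat_from y x a' b'
  | _, _ => false
  end.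

(* Potential of the automaton scanning a row [b] together with the row [a] below it; the state
   is the last letter of each row and the [last] argument of [energy_from] for each.  It is a
   lower bound on the cheapest way to reach the state, at the costs of [pot_step]. *)
Definition pot (pb : letter) (lb : option bool) (pa : letter) (la : option bool) : nat :=
  match pb with
  | Hole => ~~ is_hole pa
  | Sgn _ => if la is Some _ then la == lb else ~~ is_hole pa
  | Zero =>
      if lb is Some _ then
        if la is Some _ then (la != lb).+1 else if is_hole pa then 1 else 3
      else if is_hole pa then 2 else if la is Some _ then 3 else 0
  end.

(* Contains all the states met after the first letters. *)
Definition reach (pb : letter) (lb : option bool) (pa : letter) (la : option bool) :=
  [&& (if pb is Sgn s then lb == Some (~~ s) else true),
      (if pb is Hole then lb == None else true),
      (if pa is Sgn s then la == Some (~~ s) else true) &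
      (if pa is Hole then la == None else true)].

(** Amortised cost of one step: the gain of the upper row is paid by the lower row, by vertices at 2
    each, or by a drop in potential. States and letters are finite in number, so cases suffice. *)
Lemma pot_step pb lb pa la x y :
  reach pb lb pa la -> hole_ok pb x y -> side_ok pb y -> side_ok pa x ->
  gain pb lb y + pot y (next_last lb y) x (next_last la x)
    <= gain pa la x + 2 * one_signed pb y x + pot pb lb pa la.
Proof.
by move: pb pa x y lb la => [||[]] [||[]] [||[]] [||[]] [[]|] [[]|].
Qed.

Lemma reach_step pb lb pa la x y :
  reach pb lb pa la -> reach y (next_last lb y) x (next_last la x).
Proof. by move: pb pa x y lb la => [||[]] [||[]] [||[]] [||[]] [[]|] [[]|]. Qed.

(** Closes the scan at the last vertex, where only the lower row has a letter. The flag [z] marks a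
    lower row that is entirely zero; the last hypothesis encodes that the upper row is not. *)
Lemma pot_last (z : bool) pb lb pa la x :
  reach pb lb pa la -> hole_ok pb x Zero -> side_ok pa x ->
  (z -> [/\ is_zero pa, la = None & is_zero x]) ->
  is_hole pb || (lb != None) ->
  2 * is_hole pb + (if z then 3 else 1)
    <= gain pa la x + 2 * is_hole x + 2 * one_signed pb Zero x + pot pb lb pa la.
Proof.
case: z => reach_s ok_x side_x zeroP seen.
- have [// zero_pa -> zero_x] := zeroP isT; clear zeroP.
  by move: pb pa x lb zero_pa zero_x reach_s ok_x side_x seen
    => [||[]] [||[]] [||[]] [[]|].
- clear zeroP; move: pb pa x lb la reach_s ok_x side_x seen.
  by move=> [||[]] [||[]] [||[]] [[]|] [[]|].
Qed.

(** [Zero] never follows a hole, so after a nonzero letter either the current letter is a hole or a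
    sign is remembered. *)
Lemma seen_step pb lb y :
  side_ok pb y -> is_hole pb || (lb != None) || ~~ is_zero y ->
  is_hole y || (next_last lb y != None).
Proof. by move: pb lb y => [||[]] [[]|] [||[]]. Qed.

Lemma energy_from_step (z : bool) pb lb pa la a b :
  reach pb lb pa la -> compat_from pb pa a b ->
  (z -> [/\ is_zero pa, la = None & all is_zero a]) ->
  [|| is_hole pb, lb != None | has (predC is_zero) b] ->
  energy_from pb lb b + (if z then 3 else 1)
    <= energy_from pa la a + 2 * one_signed_count pb a b + pot pb lb pa la.
Proof.
elim: b a pb lb pa la => [|y b IHb] [|x a] pb lb pa la //= reach_s.
  case: a => //= /andP[ok_x side_x] zeroP; rewrite orbF => seen.
  have zeroP' : z -> [/\ is_zero pa, la = None & is_zero x].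
    by move/zeroP; rewrite andbT.
  by have := pot_last reach_s ok_x side_x zeroP' seen; lia.
move=> /and4P[ok_x side_y side_x compat_ab] zeroP seen.
have seen' : [|| is_hole y, next_last lb y != None | has (predC is_zero) b].
  rewrite orbA; apply/orP; case/or3P: seen => [seen|seen|/orP[seen|]]; last by right.
  - by left; apply: seen_step side_y _; rewrite seen.
  - by left; apply: seen_step side_y _; rewrite seen orbT.
  - by left; apply: seen_step side_y _; rewrite seen !orbT.
have zeroP' : z -> [/\ is_zero x, next_last la x = None & all is_zero a].
  by case/zeroP=> _ -> /andP[zero_x ->]; case: (x) zero_x.
have := IHb a _ _ _ _ (reach_step x y reach_s) compat_ab zeroP' seen'.
by have := pot_step reach_s ok_x side_y side_x; clear; lia.
Qed.

(** Telescopes [pot_step] along both rows. For nonzero rows without holes this is the inequality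
    drawn from Descartes' rule; the surplus 3 over a zero row starts the summation at row 0. *)
Lemma energy_step (z : bool) a b :
  compat a b -> (z -> all is_zero a) -> has (predC is_zero) b ->
  energy b + (if z then 3 else 1) <= energy a + 2 * one_signed_count Zero a b.
Proof.
case: a b => [|x a] [|y b] //= /andP[ok_x compat_ab] zeroP seen.
have reach0 : reach y (next_last None y) x (next_last None x).
  by case: (x) (y) => [||[]] [||[]].
have zeroP' : z -> [/\ is_zero x, next_last None x = None & all is_zero a].
  by case/zeroP/andP=> zero_x ->; case: (x) zero_x.
have seen' : [|| is_hole y, next_last None y != None | has (predC is_zero) b].
  by case: (y) seen.
have := energy_from_step reach0 compat_ab zeroP' seen'.
rewrite /energy /=.
have : 2 * is_hole y + gain Zero None y + pot y (next_last None y) x (next_last None x)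
    <= 2 * is_hole x + gain Zero None x + 2 * one_signed Zero y x.
  by clear -ok_x; move: x y ok_x => [||[]] [||[]].
by clear; lia.
Qed.

Lemma energy_from_full prev last s :
  (is_hole prev ==> (last == None)) -> all (predC is_zero) s ->
  size s + 2 * is_hole prev <= energy_from prev last s + 2 * count is_sgn s.
Proof.
elim: s prev last => [|x s IHs] prev last /= prevP; first by lia.
case/andP=> x_neq0 s_neq0; have := IHs x (next_last last x) _ s_neq0.
by case: x prev last x_neq0 prevP => [||[]] [||[]] [[]|] //= _ _ /(_ isT); lia.
Qed.

(** Runs of signs and runs of holes alternate, so their numbers differ by $1-e$, with $e$ the number
    of ends that are holes. With $h$ holes and $t$ signs the right side is at least $h+2t+1+e$, and
    $t+e\ge 1$. *)
Lemma energy_full s : all (predC is_zero) s -> 0 < size s ->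
  size s + 2 <= energy s + 2 * count is_sgn s.
Proof.
case: s => [|x s] //= /andP[x_neq0 s_neq0] _; rewrite /energy /=.
have prevP : is_hole x ==> (next_last None x == None) by case: (x).
have := energy_from_full prevP s_neq0.
by case: x x_neq0 prevP => [||[]] //= _ _; lia.
Qed.

Lemma energy_zeros s : all is_zero s -> energy s = 0.
Proof.
have zeros t : all is_zero t -> energy_from Zero None t = 0.
  by elim: t => //= -[||b] t IHt //= /IHt.
by case: s => // -[||b] s // zs; rewrite /energy zeros.
Qed.

Definition prev_of (B : nat -> letter) i := if i is i'.+1 then B i' else Zero.

Lemma one_signed_count_le (A B : nat -> letter) (P : pred nat) m :
  (forall i, one_signed (prev_of B i) (B i) (A i) -> P i) -> B m = Zero ->
  one_signed_count Zero (map A (iota 0 m.+1)) (map B (iota 0 m)) <= count P (iota 0 m.+1).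
Proof.
move=> one_signedP; suff main n j : B (j + n) = Zero ->
    one_signed_count (prev_of B j) (map A (iota j n.+1)) (map B (iota j n))
      <= count P (iota j n.+1) by exact: (main m 0).
elim: n j => [|n IHn] j Bjn.
  rewrite addn0 in Bjn; have := one_signedP j; rewrite /= Bjn addn0.
  by case: one_signed => // ->.
have := IHn j.+1; rewrite addSnnS Bjn => /(_ erefl) /=.
by have := one_signedP j; case: one_signed => [->|_] //=; lia.
Qed.

Lemma compat_map (A B : nat -> letter) m :
  (forall i, hole_ok (prev_of B i) (A i) (B i)) ->
  (forall i, i < m -> side_ok (B i) (B i.+1)) ->
  (forall i, i <= m -> side_ok (A i) (A i.+1)) ->
  B m.+1 = Zero ->
  compat (map A (iota 0 m.+2)) (map B (iota 0 m.+1)).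
Proof.
move=> okP sideB sideA Bm.
suff main n j : j + n = m ->
   compat_from (B j) (A j) (map A (iota j.+1 n.+1)) (map B (iota j.+1 n)).
  by apply/andP; split; [exact: (okP 0) | exact: (main m 0)].
elim: n j => [|n IHn] j Ejn.
  have Bj : B j.+1 = Zero by rewrite -Bm -Ejn addn0.
  have := okP j.+1; rewrite /= Bj => ->.
  by apply: sideA; lia.
apply/and4P; split; first exact: (okP j.+1).
- by apply: sideB; lia.
- by apply: sideA; lia.
- by apply: IHn; lia.
Qed.

End Rows.

(** * Connected supports in a triangle *)

Section Triangle.

Variables (R : realDomainType) (D : nat) (q : nat -> nat -> R).
Hypothesis q_out : forall k j, (D < j + k)%N -> q k j = 0.

Definition vertex k j : R :=
  q k j + (if j is j'.+1 then q k j' else 0) + (if k is k'.+1 then q k' j else 0).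

Definition row_count k : nat :=
  count (fun j => vertex k j != 0) (iota 0 (D.+2 - k)).

(** Stated with two-colourings rather than paths: a colouring that is not constant is directly a
    decomposition of the polynomial, or a cut of the triangle. *)
Definition connected_support :=
  forall c : nat -> nat -> bool,
    (forall k j, q k j != 0 -> q k j.+1 != 0 -> c k j = c k j.+1) ->
    (forall k j, q k.+1 j != 0 -> q k j != 0 -> c k.+1 j = c k j) ->
    (forall k j, q k.+1 j != 0 -> q k j.+1 != 0 -> c k.+1 j = c k j.+1) ->
  forall k j k' j', q k j != 0 -> q k' j' != 0 -> c k j = c k' j'.

(** * Holes below a zero row *)

Section Holes.

Variable k1 : nat.
Hypothesis row_k1 : forall j, q k1 j = 0.

Definition zero_between k i j :=
  all (fun x => q k x == 0) (iota (minn i j) (maxn i j - minn i j).+1).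

Lemma zero_betweenP k i j :
  reflect (forall x, (minn i j <= x <= maxn i j)%N -> q k x = 0) (zero_between k i j).
Proof.
apply: (iffP allP) => zq x Hx.
  by apply/eqP/zq; rewrite mem_iota; lia.
by apply/eqP/zq; move: Hx; rewrite mem_iota; lia.
Qed.

Definition hole_below k (h : pred nat) : pred nat := fun j =>
  (j + k <= D)%N &&
  has (fun i => zero_between k i j && (h i || (0 < i)%N && h i.-1)) (iota 0 (D - k).+1).

(** The recursion is on the distance below row [k1], from which holes spread. If [k1] exceeds [D],
    there are no holes at all. *)
Fixpoint hole_depth t : pred nat :=
  if t is t'.+1 then hole_below (k1 - t) (hole_depth t')
  else fun j => (j + k1 <= D)%N.

Definition hole k := hole_depth (k1 - k).

Lemma hole_k1 j : hole k1 j = (j + k1 <= D)%N.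
Proof. by rewrite /hole subnn. Qed.

Lemma holeE k : (k < k1)%N -> hole k =1 hole_below k (hole k.+1).
Proof.
move=> lt_k j; rewrite /hole.
have -> : (k1 - k = (k1 - k.+1).+1)%N by lia.
by rewrite /=; have -> : (k1 - (k1 - k.+1).+1 = k)%N by lia.
Qed.

Lemma hole_in k j : (k <= k1)%N -> hole k j -> (j + k <= D)%N.
Proof.
rewrite leq_eqVlt => /predU1P[->|lt_k]; first by rewrite hole_k1.
by rewrite holeE // => /andP[].
Qed.

Lemma hole_zero k j : (k <= k1)%N -> hole k j -> q k j = 0.
Proof.
rewrite leq_eqVlt => /predU1P[-> //|lt_k].
rewrite holeE // => /andP[_ /hasP[i _ /andP[/zero_betweenP zq _]]].
by apply: zq; lia.
Qed.

Lemma hole_down k i j : (k < k1)%N -> (j + k <= D)%N -> q k j = 0 ->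
  hole k.+1 i -> j = i \/ j = i.+1 -> hole k j.
Proof.
move=> lt_k le_D zq hi Ej; rewrite holeE //; apply/andP; split=> //.
apply/hasP; exists j; first by rewrite mem_iota; lia.
apply/andP; split; first by apply/zero_betweenP => x Hx; have -> : x = j by lia.
by case: Ej => ->; rewrite /= hi ?orbT.
Qed.

Lemma hole_side k i j : (k <= k1)%N -> (j + k <= D)%N -> q k j = 0 ->
  hole k i -> j = i.+1 \/ i = j.+1 -> hole k j.
Proof.
rewrite leq_eqVlt => /predU1P[->|lt_k] le_D zq; first by rewrite !hole_k1.
rewrite !holeE // => /andP[_ /hasP[x Hx /andP[/zero_betweenP zx hx]]] Ej.
apply/andP; split=> //; apply/hasP; exists x => //; rewrite hx andbT.
apply/zero_betweenP => y Hy; have [-> //|neq_y] := eqVneq y j.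
by apply: zx; lia.
Qed.

(* A chain of holes down to [j] crosses the rows from [k] up to [k1] at the positions [f]. *)
Lemma hole_chain k j : (k <= k1)%N -> hole k j ->
  exists f : nat -> nat, zero_between k (f k) j /\
    (forall l, (k <= l < k1)%N -> (f l + l <= D)%N /\ q l (f l) = 0) /\
    (forall l, (k <= l)%N -> (l.+1 < k1)%N -> exists i,
       (f l = i \/ f l = i.+1) /\ zero_between l.+1 (f l.+1) i).
Proof.
have [t] := ubnP (k1 - k); elim: t k j => // t IHt k j lt_t.
rewrite leq_eqVlt => /predU1P[->|lt_k].
  move=> hj; exists (fun=> j); split; last by split=> l; lia.
  by apply/zero_betweenP => x _; apply: row_k1.
rewrite holeE // => /andP[le_D /hasP[x]]; rewrite mem_iota => Hx /andP[zx hx].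
have [i [Ei hi]] : exists i, (x = i \/ x = i.+1) /\ hole k.+1 i.
  case/orP: hx => [hx|/andP[x_gt0 hx]]; first by exists x; split; [left|].
  by exists x.-1; split; [right; lia|].
have [||f [zf [inf linkf]]] := IHt k.+1 i _ _ hi; try lia.
exists (fun l => if l == k then x else f l); rewrite eqxx; split=> //; split.
  move=> l Hl; have [->|neq_l] := eqVneq l k; last by apply: inf; lia.
  by split; [lia | move/zero_betweenP: zx; apply; lia].
move=> l le_l lt_l; have [El|neq_l] := eqVneq l k.
  by exists i; rewrite El gtn_eqF //; split.
by rewrite gtn_eqF; [apply: linkf; lia | lia].
Qed.

(* A chain of holes from row [k1] down to row 0 would separate the cells on its left from
   those on its right. *)
Lemma hole_row0 kl kr j : connected_support ->
  (forall k i, q k i != 0 -> (k < k1)%N) ->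
  q kl 0 != 0 -> (kr <= D)%N -> q kr (D - kr) != 0 -> ~~ hole 0 j.
Proof.
move=> conn lt_k1 ql_neq0 le_kr qr_neq0; apply/negP=> hj.
have [//|f [_ [inf linkf]]] := @hole_chain 0%N j _ hj.
have neq_f k i : q k i != 0 -> i <> f k.
  move=> q_neq0 Ei; have := lt_k1 _ _ q_neq0 => lt_k.
  by case: (inf k lt_k) => _ q0; rewrite Ei q0 eqxx in q_neq0.
have out k i x y : zero_between k x y -> q k i != 0 -> ~ (minn x y <= i <= maxn x y)%N.
  by move=> /zero_betweenP zq q_neq0 Hi; rewrite zq ?eqxx in q_neq0.
(* Colour by the side of the chain: the first cell of row [kl] is on its left, the last cell of row
   [kr] is not. *)
have := conn (fun k i => (i < f k)%N) _ _ _ kl 0%N kr (D - kr)%N ql_neq0 qr_neq0.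
have := inf kr (lt_k1 _ _ qr_neq0); have := neq_f _ _ ql_neq0.
move=> Hl [Hr _] eq_c; suff: (0 < f kl)%N = (D - kr < f kr)%N by lia.
apply: eq_c => k i q1 q2.
- by have := neq_f _ _ q1; have := neq_f _ _ q2; lia.
- have [x [Ex zx]] := linkf k isT (lt_k1 _ _ q1).
  by have := neq_f _ _ q2; have := out _ _ _ _ zx q1; lia.
- have [x [Ex zx]] := linkf k isT (lt_k1 _ _ q1).
  by have := neq_f _ _ q2; have := out _ _ _ _ zx q1; lia.
Qed.

(** * Energies of the rows of the triangle *)

Definition letter_at k j : letter :=
  if hole k j then Hole else if q k j == 0 then Zero else Sgn (0 < q k j).

Definition letter_row k := map (letter_at k) (iota 0 (D - k).+1).

Lemma letter_zero k j : is_zero (letter_at k j) = ~~ hole k j && (q k j == 0).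
Proof. by rewrite /letter_at; case: hole; case: (q k j == 0). Qed.

Lemma letter_hole k j : is_hole (letter_at k j) = hole k j.
Proof. by rewrite /letter_at; case: hole; case: (q k j == 0). Qed.

Lemma letter_out k j : (k <= k1)%N -> (D < j + k)%N -> letter_at k j = Zero.
Proof.
move=> le_k lt_D; rewrite /letter_at q_out // eqxx.
by case: ifP => // /(hole_in le_k); lia.
Qed.

Variant sign_spec (x : R) : letter -> Prop :=
  | SignHole of x = 0 : sign_spec x Hole
  | SignZero of x = 0 : sign_spec x Zero
  | SignPos of 0 < x : sign_spec x (Sgn true)
  | SignNeg of x < 0 : sign_spec x (Sgn false).

Lemma letterP k j : (k <= k1)%N -> sign_spec (q k j) (letter_at k j).
Proof.
move=> le_k; rewrite /letter_at; case: ifP => [/(hole_zero le_k)|_]; first exact: SignHole.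
by case: (ltrgtP (q k j) 0) => ? /=; constructor.
Qed.

Lemma one_signed_sum x y z a b c :
  sign_spec x a -> sign_spec y b -> sign_spec z c -> one_signed a b c -> x + y + z != 0.
Proof.
case=> ?; case=> ?; case=> ? //= _; lra.
Qed.

Lemma vertex_one_signed k j (a : nat -> letter) : (k <= k1)%N ->
  sign_spec (if k is k'.+1 then q k' j else 0) (a j) ->
  one_signed (prev_of (letter_at k) j) (letter_at k j) (a j) -> vertex k j != 0.
Proof.
move=> le_k sgn_a; rewrite /vertex (addrC (q k j)).
apply: one_signed_sum sgn_a; last exact: letterP.
by case: j => [|j]; [exact: SignZero | exact: letterP].
Qed.

Lemma side_letter k j : (k <= k1)%N -> (j.+1 + k <= D)%N ->
  side_ok (letter_at k j) (letter_at k j.+1).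
Proof.
move=> le_k le_D; rewrite /side_ok !letter_hole !letter_zero.
apply/andP; split; apply/implyP=> hj; rewrite negb_and negbK orbC -implybE.
- by apply/implyP=> /eqP q0; apply: (hole_side le_k le_D q0 hj); left.
- apply/implyP=> /eqP q0; apply: (hole_side le_k _ q0 hj); last by right.
  by lia.
Qed.

Lemma letter_row_nonzero k i : (k <= k1)%N -> q k i != 0 -> has (predC is_zero) (letter_row k).
Proof.
move=> le_k q_neq0; rewrite has_map; apply/hasP; exists i.
  rewrite mem_iota; apply: contraNT q_neq0 => Hi; apply/eqP/q_out; lia.
by rewrite /= letter_zero (negPf q_neq0) andbF.
Qed.

Lemma energy_row_step k i : (k.+1 < k1)%N -> (k < D)%N -> q k.+1 i != 0 ->
  (energy (letter_row k.+1) + 1 <= energy (letter_row k) + 2 * row_count k.+1)%N.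
Proof.
move=> lt_k lt_D q_neq0.
have ED : (D - k = (D - k.+1).+1)%N by lia.
have outB : letter_at k.+1 (D - k.+1).+1 = Zero by apply: letter_out; lia.
have compat_k : compat (letter_row k) (letter_row k.+1).
  rewrite /letter_row ED; apply: compat_map outB => j => [|le_j|le_j]; last first.
  - by apply: side_letter; lia.
  - by apply: side_letter; lia.
  rewrite /hole_ok letter_hole letter_zero; apply/implyP=> above.
  apply/negP=> /andP[/negP no_hole /eqP q0]; apply: no_hole.
  case/orP: above => [|hj].
    case: j q0 => [//|j] q0; rewrite /prev_of letter_hole => hj.
    have := hole_in (ltnW lt_k) hj => le_D.
    by apply: (hole_down _ _ q0 hj); try lia; right.
  have := hole_in (ltnW lt_k) hj => le_D.
  by apply: (hole_down _ _ q0 hj); try lia; left.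
have := energy_step (z := false) compat_k (fun e => False_rect _ (notF e)).
move=> /(_ (letter_row_nonzero (ltnW lt_k) q_neq0)) /leq_trans; apply.
rewrite leq_add2l leq_mul2l /= /letter_row /row_count ED.
have -> : (D.+2 - k.+1 = (D - k.+1).+2)%N by lia.
apply: one_signed_count_le outB => j; apply: vertex_one_signed => //; first exact: ltnW.
by apply: letterP; lia.
Qed.

Lemma energy_row0 i : (0 < k1)%N -> (forall j, ~~ hole 0 j) -> q 0 i != 0 ->
  (energy (letter_row 0) + 3 <= 2 * row_count 0)%N.
Proof.
move=> k1_gt0 no_hole q_neq0.
have outB : letter_at 0 D.+1 = Zero by apply: letter_out; lia.
(* A virtual zero row under row 0; it is compatible with row 0 only because the latter has no
   hole. *)
pose below := fun _ : nat => Zero.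
have compat0 : compat (map below (iota 0 D.+2)) (letter_row 0).
  rewrite /letter_row subn0; apply: compat_map outB => // j => [|le_j].
    rewrite /hole_ok letter_hole (negPf (no_hole j)) orbF.
    by case: j => [//|j]; rewrite letter_hole (negPf (no_hole j)).
  by apply: side_letter; lia.
have zero_below : all is_zero (map below (iota 0 D.+2)) by rewrite all_map; apply/allP.
have := energy_step (z := true) compat0 (fun _ => zero_below).
move=> /(_ (letter_row_nonzero (leq0n _) q_neq0)) /leq_trans; apply.
rewrite (energy_zeros zero_below) add0n leq_mul2l /= /letter_row /row_count subn0.
apply: one_signed_count_le outB => j; apply: vertex_one_signed => //; exact: SignZero.
Qed.

Lemma energy_rows kl kr : connected_support ->
  (forall k i, q k i != 0 -> (k < k1)%N) ->
  (forall k, (k < k1)%N -> exists j, q k j != 0) ->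
  q kl 0 != 0 -> (kr <= D)%N -> q kr (D - kr) != 0 ->
  forall k, (k < k1)%N ->
    (energy (letter_row k) + k + 3 <= 2 * \sum_(l < k.+1) row_count l)%N.
Proof.
move=> conn lt_k1 row_neq0 ql_neq0 le_kr qr_neq0; elim=> [|k IHk] lt_k.
  have [i q_neq0] := row_neq0 _ lt_k.
  rewrite big_ord_recl big_ord0 !addn0; apply: energy_row0 q_neq0 => // j.
  exact: hole_row0 conn lt_k1 ql_neq0 le_kr qr_neq0.
have [i q_neq0] := row_neq0 _ lt_k.
have lt_D : (k < D)%N.
  by rewrite ltnNge; apply: contra_neqN q_neq0 => le_D; apply: q_out; lia.
have := energy_row_step lt_k lt_D q_neq0; have := IHk (ltnW lt_k).
by rewrite [in X in _ -> _ -> X]big_ord_recr /=; lia.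
Qed.

(** Just below the zero row every zero is a hole, so [energy_full] applies to the $D-k+1$ letters. A
    vertex of row [k1] sees only one cell, in row [k], so each sign yields a nonzero vertex. *)
Lemma energy_top k i : k1 = k.+1 -> q k i != 0 ->
  (D - k + 3 <= energy (letter_row k) + 2 * row_count k1)%N.
Proof.
move=> Ek q_neq0.
have le_D : (i + k <= D)%N.
  by rewrite leqNgt; apply: contra_neqN q_neq0 => lt_D; apply: q_out.
have full : all (predC is_zero) (letter_row k).
  rewrite all_map; apply/allP=> j; rewrite mem_iota /= letter_zero => Hj.
  apply/negP=> /andP[/negP no_hole /eqP q0]; apply: no_hole.
  (* The last cell has only the cell [j - 1] above it; if it is also the first one, it is the
     nonzero cell [i]. *)
  have [le_j|lt_j] := leqP (j + k1) D.
    by apply: (hole_down _ _ q0 (i := j)); rewrite -?Ek ?hole_k1; try lia; left.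
  case: j Hj q0 lt_j => [|j] Hj q0 lt_j.
    by have Ei : i = 0%N by [lia]; rewrite Ei q0 eqxx in q_neq0.
  by apply: (hole_down _ _ q0 (i := j)); rewrite -?Ek ?hole_k1; try lia; right.
have := energy_full full; rewrite size_map size_iota => /(_ isT).
have : (count is_sgn (letter_row k) <= row_count k1)%N.
  rewrite /row_count Ek subSS count_map (_ : D.+1 - k = (D - k).+1)%N; last by lia.
  apply: sub_count => j /=; rewrite /vertex -Ek row_k1 Ek add0r.
  have -> : (if j is j'.+1 then q k.+1 j' else 0) = 0 by case: (j) => // j'; rewrite -Ek row_k1.
  rewrite add0r; have := @letterP k j _; rewrite Ek => /(_ (leqnSn k)).
  by case: (letter_at k j) / => // [/lt0r_neq0|/ltr0_neq0].
by lia.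
Qed.

End Holes.

Theorem connected_triangle_count kl kr j0 : connected_support ->
  q kl 0 != 0 -> (kr <= D)%N -> q kr (D - kr) != 0 -> q 0 j0 != 0 ->
  (D + 6 <= 2 * \sum_(k < D.+2) row_count k)%N.
Proof.
move=> conn ql_neq0 le_kr qr_neq0 q0_neq0.
have zero_rowP k : reflect (forall j, q k j = 0) (all (fun j => q k j == 0) (iota 0 D.+1)).
  apply: (iffP allP) => [zq j|zq j _]; last by rewrite zq.
  have [lt_j|le_j] := ltnP j D.+1; first by apply/eqP/zq; rewrite mem_iota.
  by apply: q_out; lia.
have ex_zero : exists k, all (fun j => q k j == 0) (iota 0 D.+1).
  by exists D.+1; apply/zero_rowP=> j; apply: q_out; lia.
case: (ex_minnP ex_zero) => k1 /zero_rowP row_k1 k1_min.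
have row_neq0 k : (k < k1)%N -> exists j, q k j != 0.
  move=> lt_k; have : ~~ all (fun j => q k j == 0) (iota 0 D.+1).
    by apply/negP=> /k1_min; lia.
  by rewrite -has_predC => /hasP[j _ qj]; exists j.
case: k1 row_k1 k1_min row_neq0 => [|k] row_k1 k1_min row_neq0.
  by rewrite row_k1 eqxx in q0_neq0.
(* The zero row would separate any cell above it from the nonzero cell of row 0. *)
have lt_k1 l i : q l i != 0 -> (l < k.+1)%N.
  move=> q_neq0; rewrite (_ : (l < k.+1)%N = (0 < k.+1)%N) //.
  apply: (conn (fun l _ => (l < k.+1)%N) _ _ _ l i 0%N j0) => // {l i q_neq0} l i q1 q2.
  - have : l.+1 != k.+1 by apply: contraNneq q1 => ->; rewrite row_k1.
    by lia.
  - have : l.+1 != k.+1 by apply: contraNneq q1 => ->; rewrite row_k1.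
    by lia.
have [i q_neq0] := row_neq0 k (ltnSn k).
have le_D : (k <= D)%N.
  by rewrite leqNgt; apply: contra_neqN q_neq0 => lt_D; apply: q_out; lia.
(* The energy of row [k] cancels between the two bounds, leaving $(k+3)+(D-k+3)=D+6$. *)
have := energy_rows row_k1 conn lt_k1 row_neq0 ql_neq0 le_kr qr_neq0 (ltnSn k).
have := energy_top row_k1 erefl q_neq0.
have : (\sum_(l < k.+2) row_count l <= \sum_(l < D.+2) row_count l)%N.
  rewrite -!(big_mkord xpredT) /= (@big_cat_nat _ _ _ k.+2 0 D.+2) //= ?leq_addr //; lia.
rewrite big_ord_recr /=; lia.
Qed.

End Triangle.

(** * Polynomials in three variables *)

Section Poly3.

Variable R : realFieldType.
Implicit Types P Q T : mpoly3 R.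

Definition sum3 : mpoly3 R := X0 R + X1 R + X2 R.

Lemma poly3P P Q : (forall i j k, coef3 P i j k = coef3 Q i j k) -> P = Q.
Proof. by move=> eqPQ; do 3![apply/polyP=> ?]; apply: eqPQ. Qed.

Lemma coef3D P Q i j k : coef3 (P + Q) i j k = coef3 P i j k + coef3 Q i j k.
Proof. by rewrite /coef3 !coefD. Qed.

Lemma coef3_monomial a b c P i j k :
  coef3 (monomial3 R a b c * P) i j k =
  if [&& a <= i, b <= j & c <= k]%N then coef3 P (i - a) (j - b) (k - c) else 0.
Proof.
rewrite /coef3 /monomial3 /X0 /X1 /X2 -!polyC_exp -!mulrA !coefCM !coefXnM.
by case: (ltnP i a) => _; case: (ltnP j b) => _; case: (ltnP k c) => _; rewrite ?coef0.
Qed.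

Lemma coef3_sum3 P i j k :
  coef3 (sum3 * P) i j k =
    (if i is i'.+1 then coef3 P i' j k else 0) +
    (if j is j'.+1 then coef3 P i j' k else 0) +
    (if k is k'.+1 then coef3 P i j k' else 0).
Proof.
rewrite /sum3 !mulrDl !coef3D /coef3 /X0 /X1 /X2 !coefCM !coefXM.
by case: i j k => [|i] [|j] [|k] //=; rewrite ?coef0.
Qed.

Lemma monomial3_neq0 a b c : monomial3 R a b c != 0.
Proof. by rewrite /monomial3 !mulf_neq0 ?expf_neq0 ?polyC_eq0 ?polyX_eq0. Qed.

Lemma eval3D P Q x y z : eval3 (P + Q) x y z = eval3 P x y z + eval3 Q x y z.
Proof. by rewrite /eval3 !hornerD. Qed.

Lemma eval3M P Q x y z : eval3 (P * Q) x y z = eval3 P x y z * eval3 Q x y z.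
Proof. by rewrite /eval3 !hornerM. Qed.

Lemma eval3_sum3 x y z : eval3 sum3 x y z = x + y + z.
Proof. by rewrite /sum3 !eval3D /eval3 /X0 /X1 /X2 !hornerE. Qed.

Lemma sum3_neq0 : sum3 != 0.
Proof.
apply/eqP=> sum3_0; have := eval3_sum3 1 0 0; rewrite sum3_0 /eval3 !horner0 !addr0.
by move/eqP; rewrite eq_sym oner_eq0.
Qed.

Lemma supp3P P i j k : ((i, j, k) \in supp3 P) = (coef3 P i j k != 0).
Proof.
rewrite mem_filter /=; apply: andb_idr => Pn0.
apply/flattenP; exists [seq (i, j, k) | j <- iota 0 (size P`_k), i <- iota 0 (size (P`_k)`_j)].
  apply/mapP; exists k => //; rewrite mem_iota /= add0n ltnNge.
  by apply: contraNN Pn0 => /(nth_default 0); rewrite /coef3 => ->; rewrite !coef0.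
apply/allpairsPdep; exists j, i; split=> //; rewrite mem_iota /= add0n ltnNge.
  by apply: contraNN Pn0 => /(nth_default 0); rewrite /coef3 => ->; rewrite coef0.
by apply: contraNN Pn0 => /(nth_default 0); rewrite /coef3 => ->.
Qed.

Lemma infinite_roots (A : idomainType) (p : {poly A}) (f : nat -> A) :
  injective f -> (forall n, p.[f n] = 0) -> p = 0.
Proof.
move=> inj_f pf0; apply: (@roots_geq_poly_eq0 _ _ (map f (iota 0 (size p)))).
- by apply/allP=> _ /mapP[n _ ->]; apply/rootP.
- by rewrite map_inj_uniq ?iota_uniq.
- by rewrite size_map size_iota.
Qed.

(** Division by $X_2-u$, with $u=-(X_0+X_1)$, leaves a remainder in $X_0,X_1$ that vanishes at all
    positive integer points. Restricting to positive [x], [y] lets a monomial factor be cancelled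
    beforehand. *)
Lemma vanishing_factor P :
  (forall x y, 0 < x -> 0 < y -> eval3 P x y (- (x + y)) = 0) ->
  exists Q, P = sum3 * Q.
Proof.
move=> vanish; pose u : {poly {poly R}} := - ('X%:P + 'X).
have [T defP] : exists T, P - (P.[u])%:P = T * ('X - u%:P).
  by apply/factor_theorem; rewrite /root hornerD hornerN hornerC subrr.
have evalu x y : (P.[u]).[y%:P].[x] = eval3 P x y (- (x + y)).
  have -> : P = T * ('X - u%:P) + (P.[u])%:P by rewrite -defP subrK.
  rewrite eval3D eval3M /eval3 /u !(hornerE, hornerC).
  by rewrite subrr !mulr0.
have inj_nat : injective (fun n => n.+1%:R : R).
  by move=> m n /eqP; rewrite eqr_nat eqSS => /eqP.
have Pu0 : P.[u] = 0.
  apply: (@infinite_roots _ _ (fun n => (n.+1%:R : R)%:P)) => [m n /polyC_inj/inj_nat //|n].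
  by apply: (infinite_roots inj_nat) => m; rewrite evalu vanish ?ltr0n.
exists T; move: defP; rewrite Pu0 subr0 => ->; rewrite mulrC; congr (_ * _).
by rewrite /u /sum3 /X0 /X1 /X2 polyCN polyCD opprK addrC.
Qed.

Definition poly3_of n (f : nat -> nat -> nat -> R) : mpoly3 R :=
  \poly_(k < n) \poly_(j < n) \poly_(i < n) f i j k.

Lemma coef3_poly3_of n f i j k :
  coef3 (poly3_of n f) i j k = if [&& i < n, j < n & k < n]%N then f i j k else 0.
Proof.
rewrite /coef3 /poly3_of coef_poly; case: (ltnP k n) => _; last by rewrite !coef0 !andbF.
by rewrite coef_poly; case: (ltnP j n) => _; rewrite ?coef0 ?andbF // coef_poly andbT; case: ltnP.
Qed.

(** The nonzero terms all have one colour, so one of the two colour classes contributes nothing. *)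
Lemma split_sum (x y z : R) (c1 c2 c3 : bool) :
  (x != 0 -> y != 0 -> c1 = c2) -> (z != 0 -> x != 0 -> c3 = c1) ->
  (z != 0 -> y != 0 -> c3 = c2) ->
  (if c1 then x else 0) + (if c2 then y else 0) + (if c3 then z else 0) != 0 ->
  (if c1 then 0 else x) + (if c2 then 0 else y) + (if c3 then 0 else z) = 0.
Proof.
have [->|x0] := eqVneq x 0; have [->|y0] := eqVneq y 0; have [->|z0] := eqVneq z 0;
  case: c1; case: c2; case: c3; rewrite ?addr0 ?add0r ?eqxx // => H1 H2 H3;
  by [have := H1 isT isT | have := H2 isT isT | have := H3 isT isT].
Qed.

Lemma in_I2_multiple a b c D T : (forall i j k, coef3 T i j k != 0 -> (i + j + k)%N = D) ->
  in_I2 (monomial3 R a b c * (sum3 * T)).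
Proof.
move=> homT; split; last by move=> x y z xyz0; rewrite !eval3M eval3_sum3 xyz0 mul0r mulr0.
exists (D.+1 + (a + b + c))%N => i j k; rewrite coef3_monomial.
case: ifP => [/and3P[ai bj ck]|_]; last by rewrite eqxx.
suff homS i' j' k' : coef3 (sum3 * T) i' j' k' != 0 -> (i' + j' + k')%N = D.+1.
  by move/homS; lia.
rewrite coef3_sum3; apply: contraNeq => neq_D.
have T0 x y z : (x + y + z).+1 = (i' + j' + k')%N -> coef3 T x y z = 0.
  by move=> Exyz; apply: contraNeq neq_D => /homT; lia.
case: i' j' k' neq_D T0 => [|i'] [|j'] [|k'] neq_D T0; rewrite ?T0 ?addr0 //; lia.
Qed.

(** * The triangle of cells of a quotient, and its splitting by colours *)

Section Triangle.

Variables (Q : mpoly3 R) (D : nat).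

(** Records the part of [Q] of degree [D]; the guard excludes truncated subtractions in the exponent
    of $X_0$. *)
Definition cell k j : R := if (j + k <= D)%N then coef3 Q (D - k - j) j k else 0.

Lemma cell_out k j : (D < j + k)%N -> cell k j = 0.
Proof. by rewrite /cell ltnNge => /negPf ->. Qed.

Lemma cellE i j k : (i + j + k)%N = D -> cell k j = coef3 Q i j k.
Proof.
by move=> ED; rewrite /cell (_ : (_ <= D)%N); [congr (coef3 Q _ j k)|]; lia.
Qed.

Lemma vertexE i j k : (i + j + k)%N = D.+1 -> vertex cell k j = coef3 (sum3 * Q) i j k.
Proof.
move=> ED; rewrite coef3_sum3 /vertex; congr (_ + _ + _).
- case: i ED => [|i] ED; first by apply: cell_out; lia.
  by apply: cellE; lia.
- by case: j ED => [//|j] ED; apply: cellE; lia.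
- by case: k ED => [//|k] ED; apply: cellE; lia.
Qed.

Definition colored (c : nat -> nat -> bool) (e : bool) : mpoly3 R :=
  poly3_of D.+1 (fun i j k => if (i + j + k == D)%N && (c k j == e) then coef3 Q i j k else 0).

Lemma coef3_colored c e i j k : coef3 (colored c e) i j k =
  if (i + j + k == D)%N && (c k j == e) then coef3 Q i j k else 0.
Proof. by rewrite coef3_poly3_of; case: eqP => [ED|_]; case: ifP => //; lia. Qed.

Lemma colored_neq0 c k j : cell k j != 0 -> colored c (c k j) != 0.
Proof.
rewrite /cell; case: leqP => [le_D|_]; last by rewrite eqxx.
apply: contraNneq => col0; have := coef3_colored c (c k j) (D - k - j) j k.
rewrite col0 eqxx andbT (_ : (_ == D)%N); last by lia.
by move=> <-; rewrite /coef3 !coef0.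
Qed.

Lemma colored_sum c i j k : (i + j + k)%N = D.+1 ->
  coef3 (sum3 * colored c true) i j k + coef3 (sum3 * colored c false) i j k =
  coef3 (sum3 * Q) i j k.
Proof.
move=> ED; rewrite -coef3D -mulrDr !coef3_sum3; congr (_ + _ + _).
- case: i ED => [//|i] ED; rewrite coef3D !coef3_colored (_ : (_ == D)%N); last by lia.
  by case: c; rewrite ?addr0 ?add0r.
- case: j ED => [//|j] ED; rewrite coef3D !coef3_colored (_ : (_ == D)%N); last by lia.
  by case: c; rewrite ?addr0 ?add0r.
- case: k ED => [//|k] ED; rewrite coef3D !coef3_colored (_ : (_ == D)%N); last by lia.
  by case: c; rewrite ?addr0 ?add0r.
Qed.

Lemma colored_out c e i j k : (i + j + k)%N <> D.+1 -> coef3 (sum3 * colored c e) i j k = 0.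
Proof.
move=> neq_D; rewrite coef3_sum3.
by case: i j k neq_D => [|i] [|j] [|k] neq_D; rewrite ?coef3_colored ?addr0 //;
  do ?[rewrite (_ : (_ == D)%N = false); last by lia]; rewrite ?addr0.
Qed.

(** The cells around a vertex are pairwise adjacent, so the nonzero ones share a colour. *)
Lemma colored_disjoint c i j k :
  (forall k j, cell k j != 0 -> cell k j.+1 != 0 -> c k j = c k j.+1) ->
  (forall k j, cell k.+1 j != 0 -> cell k j != 0 -> c k.+1 j = c k j) ->
  (forall k j, cell k.+1 j != 0 -> cell k j.+1 != 0 -> c k.+1 j = c k j.+1) ->
  coef3 (sum3 * colored c true) i j k != 0 -> coef3 (sum3 * colored c false) i j k = 0.
Proof.
move=> c_row c_down c_diag; have [ED|neq_D] := eqVneq (i + j + k)%N D.+1; last first.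
  by move=> _; apply: colored_out; apply/eqP.
pose y := if j is j'.+1 then cell k j' else 0.
pose z := if k is k'.+1 then cell k' j else 0.
have coefE e : coef3 (sum3 * colored c e) i j k = (if c k j == e then cell k j else 0) +
    (if c k j.-1 == e then y else 0) + (if c k.-1 j == e then z else 0).
  rewrite coef3_sum3; congr (_ + _ + _).
  - case: i ED => [|i] ED; first by rewrite cell_out ?if_same //; lia.
    have ED' : (i + j + k)%N = D by lia.
    by rewrite coef3_colored ED' eqxx (cellE ED').
  - rewrite /y; case: j {y z} ED => [|j] ED; first by rewrite if_same.
    have ED' : (i + j + k)%N = D by lia.
    by rewrite coef3_colored ED' eqxx (cellE ED').
  - rewrite /z; case: k {y z} ED => [|k] ED; first by rewrite if_same.
    have ED' : (i + j + k)%N = D by lia.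
    by rewrite coef3_colored ED' eqxx (cellE ED').
rewrite !coefE !eqb_id => sum_neq0.
have := split_sum _ _ _ sum_neq0; rewrite !eqbF_neg !if_neg; apply.
- rewrite /y; case: (j) => [|j'] q1 q2; first by rewrite eqxx in q2.
  exact/esym/c_row.
- rewrite /z; case: (k) => [|k'] q1 q2; first by rewrite eqxx in q1.
  exact/esym/c_down.
- rewrite /y /z; case: (j) (k) => [|j'] [|k'] q1 q2; rewrite ?eqxx // in q1 q2.
  exact/esym/c_diag.
Qed.

End Triangle.

Lemma min_exponent (f : nat * nat * nat -> nat) P : P != 0 ->
  exists2 t, t \in supp3 P & {in supp3 P, forall t', (f t <= f t')%N}.
Proof.
move=> P_neq0; have [t0 t0P] : exists t, t \in supp3 P.
  case: (supp3 P) (supp3P P) => [|t s] suppP; last by exists t; rewrite mem_head.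
  case/eqP: P_neq0; apply: poly3P => i j k; rewrite /(coef3 0) !coef0.
  by apply/eqP; move: (suppP i j k); rewrite in_nil => /esym/negbFE.
have ex_n : exists n, has (fun t => f t == n) (supp3 P).
  by exists (f t0); apply/hasP; exists t0.
case: (ex_minnP ex_n) => n /hasP[t tP /eqP ft] n_min; exists t => // t' t'P.
by rewrite ft; apply: n_min; apply/hasP; exists t'.
Qed.

(** A colouring separating two support cells would split [Q] into two nonzero parts whose multiples
    decompose [P]. *)
Lemma indecomposable_connected P Q a b c D :
  P = monomial3 R a b c * (sum3 * Q) ->
  (forall i j k, coef3 (sum3 * Q) i j k != 0 -> (i + j + k)%N = D.+1) ->
  indecomposable P -> connected_support (cell Q D).
Proof.
move=> defP homQ [_ indec] col c_row c_down c_diag.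
suff same k j k' j' : cell Q D k j != 0 -> cell Q D k' j' != 0 -> col k j -> col k' j'.
  by move=> k j k' j' q q'; apply/idP/idP; apply: same.
move=> q_neq0 q'_neq0 colT; apply: contra_notT indec => colF.
exists (monomial3 R a b c * (sum3 * colored Q D col true)).
exists (monomial3 R a b c * (sum3 * colored Q D col false)).
have hom_col e i1 j1 k1 : coef3 (colored Q D col e) i1 j1 k1 != 0 -> (i1 + j1 + k1)%N = D.
  by rewrite coef3_colored; case: (_ =P D) => //; rewrite eqxx.
split.
- by split; apply: in_I2_multiple (hom_col _).
- apply: mulf_neq0 (monomial3_neq0 _ _ _) (mulf_neq0 sum3_neq0 _).
  by have := colored_neq0 col q_neq0; rewrite colT.
- apply: mulf_neq0 (monomial3_neq0 _ _ _) (mulf_neq0 sum3_neq0 _).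
  by have := colored_neq0 col q'_neq0; rewrite (negPf colF).
- rewrite defP -!mulrDr; congr (_ * _); apply: poly3P => i1 j1 k1.
  rewrite mulrDr coef3D; have [ED|neq_D] := eqVneq (i1 + j1 + k1)%N D.+1.
    by rewrite colored_sum.
  rewrite !colored_out ?addr0; try exact/eqP.
  by apply: contraNeq neq_D => /homQ ->.
- move=> i1 j1 k1; rewrite !coef3_monomial; case: ifP => // _.
  exact: colored_disjoint.
Qed.

Lemma row_count_Nmon P Q a b c D : P = monomial3 R a b c * (sum3 * Q) ->
  (\sum_(k < D.+2) row_count D (cell Q D) k <= Nmon P)%N.
Proof.
move=> defP; pose js k := [seq j <- iota 0 (D.+2 - k) | vertex (cell Q D) k j != 0].
pose vs := [seq (D.+1 - k - j + a, j + b, k + c)%N | k <- iota 0 D.+2, j <- js k].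
have <- : size vs = (\sum_(k < D.+2) row_count D (cell Q D) k)%N.
  rewrite size_allpairs_dep sumnE big_map -(big_mkord xpredT) /= /index_iota subn0.
  by apply: eq_bigr => k _; rewrite size_filter.
apply: uniq_leq_size.
  apply: allpairs_uniq_dep => [|k _|[k j] [k' j'] _ _ /= [_ Ej Ek]].
  - exact: iota_uniq.
  - exact/filter_uniq/iota_uniq.
  - have -> : k' = k by lia.
    by have -> : j' = j by lia.
move=> t /allpairsPdep[k [j [kP jP ->]]]; move: kP jP; rewrite supp3P mem_filter !mem_iota.
move=> kP /andP[v_neq0 jP]; rewrite defP coef3_monomial !leq_addl /= !addnK.
have ED : (D.+1 - k - j + j + k)%N = D.+1 by lia.
by rewrite -(vertexE _ ED).
Qed.

End Poly3.

Theorem mainTheorem3 (R : realFieldType) (P : mpoly3 R) (d : nat) :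
  P != 0 -> in_I2 P -> indecomposable P -> is_pdeg P d ->
  (d%:Z <= 2 * (Nmon P)%:Z - 5)%R.
Proof.
move=> P_neq0 [[Dt homP] vanP] indecP [_ d_min].
(* Extract the largest monomial factor. That the least exponents are attained will show that the
   support touches the three sides. *)
have [[[a ja] ka] /[!supp3P] a_in a_min] := min_exponent (fun t => t.1.1) P_neq0.
have [[[ib b] kb] /[!supp3P] b_in b_min] := min_exponent (fun t => t.1.2) P_neq0.
have [[[ic jc] c] /[!supp3P] c_in c_min] := min_exponent (fun t => t.2) P_neq0.
have le_abc i j k : coef3 P i j k != 0 -> [/\ a <= i, b <= j & c <= k]%N.
  by rewrite -supp3P => tP; split; [exact: a_min tP | exact: b_min tP | exact: c_min tP].
pose S := poly3_of Dt.+1 (fun i j k => coef3 P (i + a) (j + b) (k + c)).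
have coefS i j k : coef3 S i j k = coef3 P (i + a) (j + b) (k + c).
  rewrite coef3_poly3_of; case: ifP => // out; apply/esym/eqP.
  by apply: contraFT out => /homP; lia.
have defP : P = monomial3 R a b c * S.
  apply: poly3P => i j k; rewrite coef3_monomial coefS.
  case: ifP => [/and3P[ai bj ck]|out]; first by rewrite !subnK.
  by apply/eqP; apply: contraFT out => /le_abc[-> -> ->].
have homS i j k : coef3 S i j k != 0 -> (i + j + k)%N = (Dt - (a + b + c))%N.
  by rewrite coefS => /homP; lia.
have le_d : (d <= Dt - (a + b + c))%N.
  apply: leq_trans (d_min _ _ _ _ defP) _; apply/bigmax_leqP_seq => -[[i j] k].
  by rewrite supp3P => /homS <-.
have [Q defS] : exists Q, S = sum3 R * Q.
  apply: vanishing_factor => x y x_gt0 y_gt0.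
  have := vanP x y (- (x + y)) (subrr _); rewrite defP eval3M => /eqP.
  rewrite mulf_eq0 => /orP[|/eqP //].
  rewrite /monomial3 /eval3 /X0 /X1 /X2 !(hornerE, horner_exp).
  by rewrite !mulf_eq0 !expf_eq0 oppr_eq0; nra.
rewrite defS in homS coefS defP.
(* The cofactor has positive degree, because a multiple of [sum3] has no constant term. *)
have [D ED] : exists D, (Dt - (a + b + c))%N = D.+1.
  case E0: (Dt - (a + b + c))%N homS => [|D] homS; last by exists D.
  have [_ bj ck] := le_abc _ _ _ a_in.
  have := coefS 0%N (ja - b)%N (ka - c)%N; rewrite add0n !subnK // => Ea.
  rewrite -Ea in a_in; have := homS _ _ _ a_in => E00; move: a_in; rewrite coef3_sum3.
  by case: (ja - b)%N (ka - c)%N E00 => [|?] [|?] //; rewrite !addr0 eqxx.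
rewrite ED in homS le_d.
have conn := indecomposable_connected defP homS indecP.
have edge i j k : coef3 (sum3 R * Q) i j k != 0 ->
    vertex (cell Q D) k j != 0 /\ (i + j + k = D.+1)%N.
  by move=> nz; have Eijk := homS _ _ _ nz; rewrite (vertexE _ Eijk).
have coefP i j k : coef3 P i j k != 0 ->
    vertex (cell Q D) (k - c) (j - b) != 0 /\ (i - a + (j - b) + (k - c) = D.+1)%N.
  by move=> nz; have [ai bj ck] := le_abc _ _ _ nz; apply: edge; rewrite coefS !subnK.
(* A vertex with $X_0$-exponent 0 meets only cells on that side of the triangle, and one of them
   must be nonzero. The other two sides are treated likewise. *)
have [kr le_kr right_neq0] : exists2 k, (k <= D)%N & cell Q D k (D - k) != 0.
  have [] := coefP _ _ _ a_in; rewrite subnn /vertex => + ED'; rewrite cell_out; last by lia.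
  case: (ja - b)%N (ka - c)%N ED' => [|j] [|k] /= ED' v_neq0; rewrite ?addr0 ?add0r in v_neq0.
  - by rewrite eqxx in v_neq0.
  - by exists k; [lia | rewrite (_ : D - k = 0)%N //; lia].
  - by exists 0%N; [lia | rewrite (_ : D - 0 = j)%N //; lia].
  have [q0|q_neq0] := eqVneq (cell Q D k.+1 j) 0.
    by exists k; [lia | rewrite (_ : D - k = j.+1)%N; [move: v_neq0; rewrite q0 add0r | lia]].
  by exists k.+1; [lia | rewrite (_ : D - k.+1 = j)%N //; lia].
have [kl left_neq0] : exists k, cell Q D k 0 != 0.
  have [] := coefP _ _ _ b_in; rewrite subnn /vertex addr0.
  case: (kb - c)%N => [|k] v_neq0 _; first by exists 0%N; rewrite addr0 in v_neq0.
  have [q0|q_neq0] := eqVneq (cell Q D k.+1 0) 0; last by exists k.+1.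
  by exists k; rewrite q0 add0r in v_neq0.
have [j0 bottom_neq0] : exists j, cell Q D 0 j != 0.
  have [] := coefP _ _ _ c_in; rewrite subnn /vertex addr0.
  case: (jc - b)%N => [|j] v_neq0 _; first by exists 0%N; rewrite addr0 in v_neq0.
  have [q0|q_neq0] := eqVneq (cell Q D 0 j.+1) 0; last by exists j.+1.
  by exists j; rewrite q0 add0r in v_neq0.
(* Since $d\le D+1$, the bound $D+6\le 2N(P)$ is enough. *)
have := connected_triangle_count (@cell_out _ Q D) conn left_neq0 le_kr right_neq0 bottom_neq0.
by have := row_count_Nmon D defP; lia.
Qed.
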